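(* Let $G$ be a simple graph, let $A$ and $B$ be disjoint nonempty subsets of $V(G)$, let $\{G_i\colon i\in I\}$ be the set of all connected components of $G$, and let $\mathbf{P}_{A,B}$ be the set of all be-paths $P$ of $A$ and $B$ which are subgraphs of $G$. Then the following statements are equivalent: (i) The equality $G=\bigcup_{P\in\mathbf{P}_{A,B}}P$ holds, i.e., $G$ is a path-bipartite graph of $A$ and $B$. (ii) We have $V(G)=A\cup B$, and $A\cap V(G_i)\neq\varnothing\neq B\cap V(G_i)$ for every $i\in I$.
   Context: Graphs are simple (no loops, no multiple edges), have a nonempty vertex set $V(G)$ and edge set $E(G)$, and may be infinite. The union of a set of graphs is the graph whose vertex set and edge set are the unions of the vertex sets and of the edge sets. A path is a finite graph $P$ whose (distinct) vertices can be numbered $u_0,\dots,u_k$, $k\ge 1$, so that $E(P)=\{\{u_0,u_1\},\dots,\{u_{k-1},u_k\}\}$. Let $A,B$ be nonempty disjoint sets. A path $P$ is a be-path of $A$ and $B$ if $V(P)\subseteq A\cup B$ and there is exactly one edge $\{a_0,b_0\}\in E(P)$ meeting both $A$ and $B$. A graph $G$ with $A,B\subseteq V(G)$ is a path-bipartite graph of $A$ and $B$ if $G$ is the union of a nonempty set of be-paths of $A$ and $B$. *)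

(* Defs.v *)
From mathcomp Require Import all_boot.
From mathcomp Require Import boolp classical_sets.

Set Implicit Arguments.
Unset Strict Implicit.
Unset Printing Implicit Defensive.

Local Open Scope classical_set_scope.

(* Vertices are drawn from an arbitrary ambient type T, and an edge is the
   two-element set of its ends. The graph may be infinite. *)
Record graph (T : Type) := Graph {
  vertices : set T;
  edges : set (set T);
  vertices_neq0 : vertices !=set0;
  edges_pairs : forall e : set T, edges e ->
    exists x y : T,
      [/\ vertices x, vertices y, x <> y & e = [set x; y]] }.

Definition subgraph (T : Type) (H G : graph T) : Prop :=
  vertices H `<=` vertices G /\ edges H `<=` edges G.

(* G is the union of the graphs in S. This is a relation, not an operation on
   sets of graphs, because the empty union has no vertex and is not a graph:
   is_union G set0 is false. *)
Definition is_union (T : Type) (G : graph T) (S : set (graph T)) : Prop :=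
  vertices G = \bigcup_(P in S) vertices P /\
  edges G = \bigcup_(P in S) edges P.

(* Only the values u 0, ..., u k matter. *)
Definition path_numbering (T : Type) (P : graph T) (k : nat) (u : nat -> T)
    : Prop :=
  [/\ 1 <= k,
      forall i j : nat, i <= k -> j <= k -> u i = u j -> i = j,
      vertices P = [set u i | i in [set i : nat | i <= k]] &
      edges P = [set [set u i; u i.+1] | i in [set i : nat | i < k]]].

Definition is_path (T : Type) (P : graph T) : Prop :=
  exists (k : nat) (u : nat -> T), path_numbering P k u.

(* Paths have at least one edge, hence the restriction to distinct x and y. *)
Definition connected_graph (T : Type) (G : graph T) : Prop :=
  forall x y : T, vertices G x -> vertices G y -> x <> y ->
    exists (P : graph T) (k : nat) (u : nat -> T),
      [/\ subgraph P G, path_numbering P k u, u 0 = x & u k = y].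

Definition connected_component_of (T : Type) (G H : graph T) : Prop :=
  [/\ subgraph H G, connected_graph H &
      forall K : graph T, subgraph K G -> connected_graph K ->
        subgraph H K -> subgraph K H].

Definition be_path (T : Type) (A B : set T) (P : graph T) : Prop :=
  [/\ is_path P,
      vertices P `<=` A `|` B &
      exists! e : set T, [/\ edges P e, e `&` A !=set0 & e `&` B !=set0]].

Definition be_paths_in (T : Type) (G : graph T) (A B : set T)
    : set (graph T) :=
  [set P | be_path A B P /\ subgraph P G].

Definition path_bipartite (T : Type) (A B : set T) (G : graph T) : Prop :=
  [/\ A `<=` vertices G, B `<=` vertices G &
      exists S : set (graph T),
        [/\ S !=set0, S `<=` be_path A B & is_union G S]].

(* Main.v *)
(** For (ii) => (i), take an edge xy of G with, say, x in A, and a walk of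
    minimal length from {x, y} to B. It has no repeated vertex, avoids the end
    of the edge xy at which it does not start, and meets B only at its last
    vertex; so if y lies in A, adding that end in front of it gives a be-path
    through xy. If y lies in B, the edge xy is itself a be-path. Vertices are
    covered because no vertex is isolated when each component meets both
    disjoint sets A and B. *)
Require Import Defs.
From mathcomp Require Import all_boot.
From mathcomp Require Import boolp classical_sets.
From mathcomp Require Import zify.
From Stdlib Require Import Relations.

Local Open Scope classical_set_scope.

Section Graphs.
Set Implicit Arguments.
Unset Strict Implicit.
Unset Printing Implicit Defensive.

Context {T : Type}.
Implicit Types (G H K P : graph T) (A B X Y : set T).

(** * Adjacency, reachability and walks *)

Definition adjacent G (x y : T) : Prop := edges G [set x; y].

(** Reflexive at every element of [T], including those outside [vertices G]. *)
Definition reachable G : T -> T -> Prop := clos_refl_trans T (adjacent G).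

Definition walk G (n : nat) (u : nat -> T) : Prop :=
  forall i, i < n -> adjacent G (u i) (u i.+1).

Lemma adjacent_sym G x y : adjacent G x y -> adjacent G y x.
Proof. by rewrite /adjacent setUC. Qed.

Lemma edge_vertices G e x : edges G e -> e x -> vertices G x.
Proof. by move=> /edges_pairs[a [b [Ga Gb _ ->]]] [->|->]. Qed.

Lemma adjacent_vertices G x y :
  adjacent G x y -> [/\ vertices G x, vertices G y & x <> y].
Proof.
move=> Gxy; split; first by apply: (edge_vertices Gxy); left.
  by apply: (edge_vertices Gxy); right.
move=> xy; move: Gxy; rewrite /adjacent xy.
move=> /edges_pairs[a [b [_ _ ab yab]]]; apply: ab.
have: [set y; y] a by rewrite yab; left.
have: [set y; y] b by rewrite yab; right.
by move=> [->|->] [->|->].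
Qed.

Lemma reachable_sym G x y : reachable G x y -> reachable G y x.
Proof.
elim=> [a b /adjacent_sym ab|a|a b c _ ba _ cb].
- exact: rt_step.
- exact: rt_refl.
- exact: rt_trans cb ba.
Qed.

Lemma reachable_sub H G x y :
  edges H `<=` edges G -> reachable H x y -> reachable G x y.
Proof.
move=> HG; elim=> [a b /HG ab|a|a b c _ ab _ bc].
- exact: rt_step.
- exact: rt_refl.
- exact: rt_trans ab bc.
Qed.

Lemma reachable_vertices G x y :
  vertices G x -> reachable G x y -> vertices G y.
Proof.
move=> Gx xy; elim: xy Gx => // [a b /adjacent_vertices[]//|].
by move=> a b c _ ab _ bc /ab/bc.
Qed.

Lemma walk_reachable G n u i j :
  walk G n u -> i <= n -> j <= n -> reachable G (u i) (u j).
Proof.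
move=> Gu; have from0 k : k <= n -> reachable G (u 0) (u k).
  elim: k => [_|k IHk kn]; first exact: rt_refl.
  by apply: rt_trans (IHk (ltnW kn)) _; apply: rt_step; apply: Gu.
by move=> /from0/reachable_sym i0 /from0 j0; apply: rt_trans i0 j0.
Qed.

Lemma reachable_walk G x y : reachable G x y ->
  exists n u, [/\ walk G n u, u 0 = x & u n = y].
Proof.
move=> xy; elim: (clos_rt_rt1n _ _ _ _ xy) => [a|a b c ab _ [n [u [Gu u0 un]]]].
  by exists 0, (fun=> a).
exists n.+1, (fun i => if i is j.+1 then u j else a); split=> // -[_|i /Gu//].
by rewrite u0.
Qed.

Lemma reachable_neq_adjacent G x y :
  reachable G x y -> x <> y -> exists z, adjacent G x z.
Proof. by move=> xy; case: (clos_rt_rt1n _ _ _ _ xy) => // z w xz _ _; exists z. Qed.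

(** Take a walk of minimal length among all walks from [X] to [Y]. A repeated vertex, a later vertex
    in [X] or an earlier vertex in [Y] would each allow a shorter one. *)
Lemma shortest_walk G X Y x y : X x -> Y y -> reachable G x y ->
  exists n u,
    [/\ walk G n u, X (u 0), Y (u n),
        forall i j, i <= n -> j <= n -> u i = u j -> i = j &
        (forall i, 0 < i <= n -> ~ X (u i)) /\
        (forall i, i < n -> ~ Y (u i))].
Proof.
move=> Xx Yy /reachable_walk[m [w [Gw w0 wm]]].
pose Q n := `[< exists u, [/\ walk G n u, X (u 0) & Y (u n)] >].
have exQ : exists n, Q n.
  by exists m; apply/asboolP; exists w; rewrite w0 wm; split.
case: (ex_minnP exQ) => n /asboolP[u [Gu X0 Yn]] min_n.
have {}min_n k v : walk G k v -> X (v 0) -> Y (v k) -> n <= k.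
  by move=> Gv Xv Yv; apply: min_n; apply/asboolP; exists v; split.
have inj_lt i j : i < j -> j <= n -> u i <> u j.
  move=> ij jn uij.
  (* [v] skips the closed stretch of [u] from index [i] to index [j]; its step out of [i] is the
     step of [u] out of [j], as [u i = u j]. *)
  pose v k := if k <= i then u k else u (k + (j - i)).
  suff: n <= n - (j - i) by move=> ?; lia.
  apply: (min_n _ v) => [k kn||]; rewrite /v ?leq0n//.
    have [ki|ik|kEi] := ltngtP k i.
    - by apply: Gu; lia.
    - by rewrite addSn; apply: Gu; lia.
    - by rewrite kEi uij (_ : i.+1 + (j - i) = j.+1); [apply: Gu|]; lia.
  (* The end of [v] must lie in [Y]. If its index is at most [i], then [j = n] and [v] stops at
     [u i = u n]. *)
  case: leqP => [ni|_]; last by rewrite subnK//; lia.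
  have jn_eq : j = n by lia.
  have -> : n - (j - i) = i by lia.
  by rewrite uij jn_eq.
exists n, u; split=> //.
  move=> i j iN jN uij; case: (ltngtP i j) => // ij.
    by case: (inj_lt _ _ ij jN).
  by case: (inj_lt _ _ ij iN).
split=> i.
  (* Dropping the first [i] steps leaves a walk that still starts in [X]. *)
  move=> /andP[i0 iN] Xi; suff: n <= n - i by move=> ?; lia.
  apply: (min_n _ (fun k => u (k + i))) => [k kn|//|].
  - by apply: Gu; lia.
  - by rewrite /= subnK.
move=> iN Yi; suff: n <= i by move=> ?; lia.
by apply: (min_n _ u) => // k ki; apply: Gu; lia.
Qed.

(** * Paths and connected components *)

Lemma walk_path G k u : 0 < k -> walk G k u ->
  (forall i j, i <= k -> j <= k -> u i = u j -> i = j) ->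
  exists P, path_numbering P k u /\ subgraph P G.
Proof.
move=> k0 Gu inj_u.
pose V := [set u i | i in [set i : nat | i <= k]].
pose E := [set [set u i; u i.+1] | i in [set i : nat | i < k]].
have V0 : V !=set0 by exists (u 0), 0.
have EV e : E e -> exists x y, [/\ V x, V y, x <> y & e = [set x; y]].
  move=> [i /= ik <-]; exists (u i), (u i.+1); split=> //.
  - by exists i => //=; lia.
  - by exists i.+1.
  - by move=> /inj_u; lia.
exists (Graph V0 EV); split; first by split.
split=> [_ [i /= ik <-]|_ [i /= ik <-]]; last exact: Gu.
(* A vertex of the walk belongs to [G] as an end of an edge: the first edge for [u 0], which exists
   since [0 < k], and the preceding edge otherwise. *)
case: i ik => [|i] ik; first by have [] := adjacent_vertices (Gu 0 k0).
by have [] := adjacent_vertices (Gu i ik).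
Qed.

Lemma reachable_path G x y : x <> y -> reachable G x y ->
  exists P k u, [/\ subgraph P G, path_numbering P k u, u 0 = x & u k = y].
Proof.
move=> xy xGy.
have [n [u [Gu u0 un inj_u _]]] :=
  shortest_walk (X := [set x]) (Y := [set y]) erefl erefl xGy.
have n0 : 0 < n by case: n un {Gu inj_u} => // uy; case: xy; rewrite -u0.
have [P [Pu PG]] := walk_path n0 Gu inj_u.
by exists P, n, u.
Qed.

Lemma path_numbering_walk P k u : path_numbering P k u -> walk P k u.
Proof. by move=> [_ _ _ PE] i ik; rewrite /adjacent PE; exists i. Qed.

Lemma path_reachable P x y :
  is_path P -> vertices P x -> vertices P y -> reachable P x y.
Proof.
move=> [k [u Pu]]; have [_ _ -> _] := Pu => -[i /= ik <-] [j /= jk <-].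
exact: walk_reachable (path_numbering_walk Pu) ik jk.
Qed.

Lemma connected_reachable H x y :
  connected_graph H -> vertices H x -> vertices H y -> reachable H x y.
Proof.
move=> cH Hx Hy; have [->|xy] := pselect (x = y); first exact: rt_refl.
have [P [k [u [[_ PH] Pu <- <-]]]] := cH x y Hx Hy xy.
exact: reachable_sub PH (walk_reachable (path_numbering_walk Pu) _ _).
Qed.

(** [K] is the subgraph of [G] induced on the vertices reachable from [x]. The last clause, stronger
    than maximality, serves to compare [K] with any other component through [x]. *)
Lemma component_at G x : vertices G x ->
  exists K, [/\ connected_component_of G K, vertices K = reachable G x &
    forall L, subgraph L G -> connected_graph L -> vertices L x ->
      subgraph L K].
Proof.
move=> Gx.
pose V : set T := reachable G x.
pose E : set (set T) := [set e | edges G e /\ e `<=` V].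
have V0 : V !=set0 by exists x; apply: rt_refl.
have EV e : E e -> exists a b, [/\ V a, V b, a <> b & e = [set a; b]].
  move=> [/edges_pairs[a [b [_ _ ab ->]]] eV].
  by exists a, b; split=> //; apply: eV; [left|right].
pose K := Graph V0 EV.
have KG : subgraph K G.
  by split=> [y|e []//]; apply: reachable_vertices.
have adjK a b : V a -> adjacent G a b -> adjacent K a b.
  move=> Va ab; split=> // c [->//|->].
  by apply: rt_trans Va _; apply: rt_step.
have xK y : V y -> reachable K x y.
  (* Steps are added at the far end, so that each vertex passed is known to be reachable from [x],
     as [adjK] requires. *)
  move=> Vy; elim: (clos_rt_rtn1 _ _ _ _ Vy) => [|a b ab xa xKa]; first exact: rt_refl.
  apply: rt_trans xKa _; apply: rt_step; apply: adjK ab.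
  exact: clos_rtn1_rt.
have maxK L : subgraph L G -> connected_graph L -> vertices L x -> subgraph L K.
  move=> [LG_v LG_e] cL Lx.
  have LV : vertices L `<=` V.
    by move=> y Ly; apply: reachable_sub LG_e (connected_reachable cL Lx Ly).
  by split=> // e Le; split; [apply: LG_e|move=> y /(edge_vertices Le)/LV].
exists K; split=> //; split=> //.
  move=> a b Va Vb ab; apply: reachable_path ab _.
  by apply: rt_trans (xK b Vb); apply: reachable_sym; apply: xK.
by move=> L LG cL [KL_v _]; apply: maxK => //; apply: KL_v; apply: rt_refl.
Qed.

(** The component [K] of [component_at] contains [H], and the maximality of [H] gives the reverse
    inclusion. *)
Lemma component_vertices G H x :
  connected_component_of G H -> vertices H x -> vertices H = reachable G x.
Proof.
move=> [HG cH maxH] Hx; have [K [[KG cK _] KV inK]] := component_at (HG.1 x Hx).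
have HK := inK H HG cH Hx; have KH := maxH K KG cK HK.
by rewrite -KV; apply/seteqP; split; [exact: HK.1|exact: KH.1].
Qed.

(** * Construction of be-paths from walks *)

Lemma be_path_swap A B P : be_path A B P -> be_path B A P.
Proof.
move=> [pP PAB [e [[Pe eA eB] e_uniq]]]; split=> //; first by rewrite setUC.
by exists e; split=> // f [Pf fB fA]; apply: e_uniq.
Qed.

(** By disjointness [u k] is the only vertex in [B], so only the last edge can meet [B]. *)
Lemma be_path_numbering A B P k u : A `&` B = set0 ->
  path_numbering P k u -> (forall i, i < k -> A (u i)) -> B (u k) ->
  be_path A B P.
Proof.
move=> AB0 Pu uA uB; have [k0 _ PV PE] := Pu.
have notAB x : A x -> ~ B x.
  by move=> Ax Bx; have: (A `&` B) x by []; rewrite AB0.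
split; first by exists k, u.
  rewrite PV => _ [i /= ik <-].
  by have [/uA|ki|->] := ltngtP i k; [left|lia|right].
exists [set u k.-1; u k]; split.
  rewrite PE; split; first by exists k.-1; rewrite /= prednK.
  - by exists (u k.-1); split; [left|apply: uA; lia].
  - by exists (u k); split=> //; right.
rewrite PE => _ [[i /= ik <-] _ [b [[->|->] Bb]]].
  by case: (notAB _ (uA i ik)).
have [|->] : i.+1 < k \/ k = i.+1; [lia| |by []].
by move=> /uA/notAB.
Qed.

Section BePaths.
Context {G : graph T} {A B : set T}.
Hypotheses (AB0 : A `&` B = set0) (GAB : vertices G = A `|` B).

Lemma be_path_cons z n u : A z -> adjacent G z (u 0) -> walk G n u ->
  (forall i, i <= n -> u i <> z) ->
  (forall i j, i <= n -> j <= n -> u i = u j -> i = j) ->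
  (forall i, i < n -> A (u i)) -> B (u n) ->
  exists2 P, be_paths_in G A B P & edges P [set z; u 0].
Proof.
move=> Az zu Gu uz inj_u uA uB.
pose v i := if i is j.+1 then u j else z.
have Gv : walk G n.+1 v by move=> [|i] //; apply: Gu.
have inj_v i j : i <= n.+1 -> j <= n.+1 -> v i = v j -> i = j.
  case: i j => [|i] [|j] //= ni nj; last by move=> /inj_u->.
    by move=> /esym/uz; case.
  by move=> /uz; case.
have [P [Pv PG]] := walk_path (ltn0Sn n) Gv inj_v.
exists P; last by have [_ _ _ ->] := Pv; exists 0.
by split=> //; apply: be_path_numbering Pv _ _ => // -[|i] //; apply: uA.
Qed.

Lemma be_path_through_edge x y b : A x -> adjacent G x y ->
  B b -> reachable G x b -> exists2 P, be_paths_in G A B P & edges P [set x; y].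
Proof.
move=> Ax xy Bb xb; have [_ Gy neq_xy] := adjacent_vertices xy.
have [By|nBy] := pselect (B y).
  (* A walk of length 0 at [y], preceded by [x], is the single edge. *)
  apply: (@be_path_cons x 0 (fun=> y)) => //.
  - by move=> _ _ /esym.
  - by move=> i j; rewrite !leqn0 => /eqP-> /eqP->.
have Ay : A y by move: Gy; rewrite GAB => -[].
have [|n [u [Gu u0 uB inj_u [u_xy u_B]]]] :=
  shortest_walk (X := [set x; y]) _ Bb xb; first by left.
have uA i : i < n -> A (u i).
  move=> ni; have [Gui _ _] := adjacent_vertices (Gu i ni).
  by move: Gui (u_B i ni); rewrite GAB => -[].
(* The walk may start at either end of the edge. The other end goes in front: it differs from [u 0]
   by [neq_xy] and from the later vertices by [u_xy]. *)
case: u0 => u0.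
  rewrite setUC -u0; apply: (be_path_cons (n := n)) => //.
    by rewrite u0; apply: adjacent_sym.
  move=> [|i] ni uiy; first by apply: neq_xy; rewrite -u0.
  by apply: (u_xy i.+1) => //; right.
rewrite -u0; apply: (be_path_cons (n := n)) => //; first by rewrite u0.
move=> [|i] ni uix; first by apply: neq_xy; rewrite -u0.
by apply: (u_xy i.+1) => //; left.
Qed.

End BePaths.

End Graphs.

Theorem theorem2p10 (T : Type) (G : graph T) (A B : set T)
    (A_neq0 : A !=set0) (B_neq0 : B !=set0) (disjAB : A `&` B = set0)
    (AG : A `<=` vertices G) (BG : B `<=` vertices G) :
  (is_union G (be_paths_in G A B) <-> path_bipartite A B G) /\
  (is_union G (be_paths_in G A B) <->
     vertices G = A `|` B /\
     forall H : graph T, connected_component_of G H ->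
       A `&` vertices H !=set0 /\ B `&` vertices H !=set0).
Proof.
split; split.
- move=> GU; split=> //; exists (be_paths_in G A B); split=> //; last by move=> P [].
  by have [x] := vertices_neq0 G; rewrite GU.1 => -[P GP _]; exists P.
- move=> [_ _ [S [_ SAB [GV GE]]]].
  (* The members of [S] are subgraphs of their union [G], so enlarging [S] to all be-paths in [G]
     does not change the union. *)
  have SG P : S P -> be_paths_in G A B P.
    move=> SP; split; first exact: SAB.
    by split; [rewrite GV|rewrite GE]; exact: bigcup_sup.
  split; apply/seteqP; split.
  + by rewrite {1}GV => x [P /SG]; exists P.
  + by move=> x [P [_ [PG _]] /PG].
  + by rewrite {1}GE => e [P /SG]; exists P.
  + by move=> e [P [_ [_ PG]] /PG].
- move=> [GV GE]; split.
    apply/seteqP; split=> [x|x [/AG|/BG]//].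
    by rewrite GV => -[P [[_ + _] _]]; exact.
  move=> H HG; have [v Hv] := vertices_neq0 H.
  have [[HG_v _] _ _] := HG.
  have := HG_v v Hv; rewrite GV => -[P [[pP PAB [e [[Pe eA eB] _]]] [_ PG]] Pv].
  (* A be-path [P] through a vertex [v] of [H] stays in [H], and its edge [e] supplies vertices of
     both [A] and [B]. *)
  have eH x : e x -> vertices H x.
    move=> /(edge_vertices Pe) Px; rewrite (component_vertices HG Hv).
    exact: reachable_sub PG (path_reachable pP Pv Px).
  by split; [case: eA|case: eB] => x [/eH Hx ?]; exists x.
- move=> [GAB comp].
  have reach x : vertices G x ->
      (exists2 a, A a & reachable G x a) /\ (exists2 b, B b & reachable G x b).
    move=> Gx; have [K [cK KV _]] := component_at Gx.
    have [[a [Aa xa]] [b [Bb xb]]] := comp K cK.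
    by rewrite KV in xa xb; split; [exists a|exists b].
  have cover x y : adjacent G x y ->
      exists2 P, be_paths_in G A B P & edges P [set x; y].
    move=> xy; have [Gx _ _] := adjacent_vertices xy.
    have [[a Aa xa] [b Bb xb]] := reach x Gx.
    move: (Gx); rewrite {1}GAB => -[Ax|Bx].
      exact: (be_path_through_edge disjAB GAB Ax xy Bb xb).
    (* For [x] in [B] the roles of [A] and [B] are exchanged. *)
    have BA0 : B `&` A = set0 by rewrite setIC.
    have GBA : vertices G = B `|` A by rewrite setUC.
    have [P [PBA PG] Pxy] := be_path_through_edge BA0 GBA Bx xy Aa xa.
    by exists P => //; split=> //; apply: be_path_swap.
  split; apply/seteqP; split.
  + move=> x Gx; have [y xy] : exists y, adjacent G x y.
      have [[a Aa xa] [b Bb xb]] := reach x Gx.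
      (* By disjointness [x] cannot equal both [a] and [b], so it has a neighbour on the way to one
         of them. *)
      have [ax|] := pselect (x = a); last exact: reachable_neq_adjacent.
      apply: reachable_neq_adjacent xb _ => xb.
      by have: (A `&` B) x; [split; [rewrite ax|rewrite xb]|rewrite disjAB].
    have [P GP Pxy] := cover x y xy.
    by exists P => //; apply: (edge_vertices Pxy); left.
  + by move=> x [P [_ [PG _]] /PG].
  + move=> e Ge; have [x [y [_ _ _ exy]]] := edges_pairs Ge.
    move: Ge; rewrite exy => /cover[P GP Pxy].
    by exists P.
  + by move=> e [P [_ [_ PG]] /PG].
Qed.
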